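(* The shape operator of an admissible surface in the pseudo-isotropic space $\mathbb{I}_{\mathrm p}^3$ may fail to be diagonalizable: there exist an admissible surface $S\subset\mathbb{I}_{\mathrm p}^3$ and a point $q\in S$ such that the shape operator $L_q:T_qS\to T_qS$ is not diagonalizable over $\mathbb{R}$.
   Context: The pseudo-isotropic space $\mathbb{I}_{\mathrm p}^3$ is $\mathbb{R}^3$ with the degenerate inner product $u^1v^1-u^2v^2$. A plane is isotropic if it contains a line parallel to the $z$-axis; a smooth surface is admissible if none of its tangent planes is isotropic. For a local parameterization $\mathbf{x}(u^1,u^2)$ of an admissible surface write $\mathbf{x}_i=\partial\mathbf{x}/\partial u^i=(x_i^1,x_i^2,x_i^3)$ and $X_{ij}=x_1^ix_2^j-x_1^jx_2^i$ (so $X_{12}\ne0$). The Gauss map is $$\xi^{\mathrm p}=\left(\frac{X_{23}}{X_{12}},\ \frac{X_{13}}{X_{12}},\ \frac12\left\{1-\left[\left(\frac{X_{23}}{X_{12}}\right)^2-\left(\frac{X_{13}}{X_{12}}\right)^2\right]\right\}\right).$$ The shape operator is $L_q(w)=-D_w\xi^{\mathrm p}$ for $w\in T_qS$, where $D$ is the usual directional derivative in $\mathbb{R}^3$; it is a linear operator on $T_qS$. *)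

(* Defs.v *)
From HB Require Import structures.
From mathcomp Require Import all_boot all_order all_algebra.
From mathcomp Require Import all_classical all_reals all_analysis.

Set Implicit Arguments.
Unset Strict Implicit.
Unset Printing Implicit Defensive.

Import Order.TTheory GRing.Theory Num.Theory.
Import numFieldNormedType.Exports.

Local Open Scope classical_set_scope.
Local Open Scope ring_scope.

(* Only meant for an open set U, so that the values of f outside U are
   irrelevant. *)
Fixpoint Ck_on (R : realType) (V W : normedModType R) (k : nat)
    (U : set V) (f : V -> W) : Prop :=
  match k with
  | 0 => forall x, U x -> {for x, continuous f}
  | k'.+1 => (forall x, U x -> differentiable f x) /\
             (forall v : V, Ck_on k' U (fun x => 'D_v f x))
  end.

Definition smooth_on (R : realType) (V W : normedModType R)
    (U : set V) (f : V -> W) : Prop := forall k, Ck_on k U f.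

Section Surfaces.
Variable R : realType.

(* Indices start at 0: the coordinates (x, y, z) of R^3 are those of index
   0, 1 and 2 in 'I_3, and the parameters u^1, u^2 those of index 0 and 1 in
   'I_2. *)
Definition partial (x : 'rV[R]_2 -> 'rV[R]_3) (i : 'I_2) (u : 'rV[R]_2) :
  'rV[R]_3 := 'D_(delta_mx 0 i : 'rV[R]_2) x u.

(* The condition on images of open sets says that x^-1 : x(U) -> U is
   continuous and that x(U) is relatively open in S. *)
Definition local_parameterization (S : set 'rV[R]_3)
    (U : set 'rV[R]_2) (x : 'rV[R]_2 -> 'rV[R]_3) : Prop :=
  [/\ open U,
      smooth_on U x,
      forall u, U u -> free [:: partial x 0 u; partial x 1 u],
      {in U &, injective x} &
      forall A : set 'rV[R]_2, open A -> A `<=` U ->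
        exists2 V : set 'rV[R]_3, open V & x @` A = S `&` V].

Definition smooth_surface (S : set 'rV[R]_3) : Prop :=
  forall q, S q ->
    exists (U : set 'rV[R]_2) (x : 'rV[R]_2 -> 'rV[R]_3),
      local_parameterization S U x /\ (x @` U) q.

Definition curve_through (S : set 'rV[R]_3) (q w : 'rV[R]_3)
    (c : R -> 'rV[R]_3) : Prop :=
  exists2 e : R, 0 < e &
    [/\ smooth_on `]- e, e[ c,
        forall t, - e < t < e -> S (c t),
        c 0 = q &
        'D_1 c 0 = w].

Definition tangent_space (S : set 'rV[R]_3) (q : 'rV[R]_3) :
  set 'rV[R]_3 := [set w | exists c, curve_through S q w c].

Definition tangent_plane (S : set 'rV[R]_3) (q : 'rV[R]_3) :
  set 'rV[R]_3 := [set q + w | w in tangent_space S q].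

Definition isotropic (P : set 'rV[R]_3) : Prop :=
  exists p : 'rV[R]_3, forall t : R, P (p + t *: delta_mx 0 2).

Definition admissible (S : set 'rV[R]_3) : Prop :=
  smooth_surface S /\ forall q, S q -> ~ isotropic (tangent_plane S q).

Definition minorX (x : 'rV[R]_2 -> 'rV[R]_3) (i j : 'I_3) (u : 'rV[R]_2) : R :=
  partial x 0 u 0 i * partial x 1 u 0 j - partial x 0 u 0 j * partial x 1 u 0 i.

Definition param_gauss_map (x : 'rV[R]_2 -> 'rV[R]_3) (u : 'rV[R]_2) :
    'rV[R]_3 :=
  let a := minorX x 1 2 u / minorX x 0 1 u in
  let b := minorX x 0 2 u / minorX x 0 1 u in
  \row_(i < 3) [:: a; b; 2^-1 * (1 - (a ^+ 2 - b ^+ 2))]`_i.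

(* A change of parameters multiplies the three minors by the same nonzero
   Jacobian, hence all local parameterizations of S around q give the same
   value. *)
Definition gauss_map (S : set 'rV[R]_3) (q : 'rV[R]_3) : 'rV[R]_3 :=
  xget 0 [set n | exists (U : set 'rV[R]_2) (x : 'rV[R]_2 -> 'rV[R]_3) u,
    [/\ local_parameterization S U x, U u, x u = q & n = param_gauss_map x u]].

(* The Gauss map is defined on S only, so its directional derivative at q along
   a tangent vector w is its derivative along a curve in S with velocity w at q;
   it does not depend on the curve. *)
Definition surface_derive (S : set 'rV[R]_3) (f : 'rV[R]_3 -> 'rV[R]_3)
    (q w : 'rV[R]_3) : 'rV[R]_3 :=
  xget 0 [set d | exists2 c, curve_through S q w c &
                    is_derive (0 : R) (1 : R) (f \o c) d].

Definition shape_operator (S : set 'rV[R]_3) (q w : 'rV[R]_3) : 'rV[R]_3 :=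
  - surface_derive S (gauss_map S) q w.

(* For a linear operator L on the linear subspace T: T has a basis of
   eigenvectors of L. *)
Definition diagonalizable_on (T : set 'rV[R]_3) (L : 'rV[R]_3 -> 'rV[R]_3) :
    Prop :=
  exists X : seq 'rV[R]_3,
    [/\ free X,
        T = [set w | w \in <<X>>%VS] &
        forall v, v \in X -> exists a : R, L v = a *: v].

End Surfaces.

(* Main.v *)
Require Import Defs.
From HB Require Import structures.
From mathcomp Require Import all_boot all_order all_algebra.
From mathcomp Require Import all_classical all_reals all_analysis.
From mathcomp Require Import ring.
Local Open Scope classical_set_scope.
Local Open Scope ring_scope.
Import Order.TTheory GRing.Theory Num.Theory.
Import numFieldNormedType.Exports.

(** The saddle z = x y has a shape operator without real eigenvectors.  For a
    graph z = f(x, y) the Gauss map is (- f_x, f_y, ...), so in the horizontal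
    projection the shape operator has matrix
    (f_xx, f_xy; - f_xy, - f_yy).  The sign coming from the indefinite metric
    destroys the symmetry that makes shape operators diagonalizable in Euclidean
    space, and for f = x y the matrix is (0, 1; -1, 0), a rotation by a right
    angle.

    Since the Gauss map and its derivative are picked among all local
    parameterizations and all curves, the work lies in showing that the picked
    values are the expected ones.  The key is [saddle_tangent]: whatever
    moves on the saddle has velocity w with w_z = x w_y + y w_x.  Applied to the
    partial derivatives of an arbitrary local parameterization, this gives the
    ratios of minors, hence the Gauss map ([param_gauss_map_saddle]); applied to
    curves, it bounds the tangent spaces, hence admissibility
    ([admissible_saddle]).  The Gauss map is then an explicit polynomial map on
    the saddle, and [shape_operator_saddle] differentiates it along curves. *)

Set Implicit Arguments.
Unset Strict Implicit.

(** * Derivatives of vector-valued maps *)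

Lemma row3P (R : realType) (v w : 'rV[R]_3) :
  v 0 0 = w 0 0 -> v 0 1 = w 0 1 -> v 0 2 = w 0 2 -> v = w.
Proof.
move=> h0 h1 h2; apply/rowP => -[[|[|[|//]]] hi].
- by rewrite (_ : Ordinal hi = 0)//; exact: val_inj.
- by rewrite (_ : Ordinal hi = 1)//; exact: val_inj.
- by rewrite (_ : Ordinal hi = 2)//; exact: val_inj.
Qed.

Lemma is_derive_mxP (R : realType) (V : normedModType R) (m n : nat)
    (M : V -> 'M[R]_(m, n)) (t v : V) (dM : 'M[R]_(m, n)) :
  is_derive t v M dM <->
  forall i j, is_derive t v (fun x => M x i j : R) (dM i j).
Proof.
split=> [[dM1 <-] i j|h].
  apply: DeriveDef; first exact/(derivable_mxP M t v).1.
  by rewrite derive_mx// mxE.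
have dM1 : derivable M t v.
  by apply/derivable_mxP => i j; have [] := h i j.
apply: DeriveDef => //; rewrite derive_mx//.
by apply/matrixP => i j; rewrite mxE; have [] := h i j.
Qed.

Lemma is_diff_coord (R : realType) m n (M : 'M[R]_(m, n)) i j :
  is_diff M (fun N : 'M[R]_(m, n) => N i j : R) (fun N => N i j).
Proof.
apply: DiffDef; first exact: differentiable_coord.
apply/funext => N.
have := @deriveE _ _ _ (fun N : 'M[R]_(m, n) => N i j : R) M N.
move=> <-; last exact: differentiable_coord.
by have [_ ->] := (is_derive_mxP id M N N).1 (is_derive_id _ _) i j.
Qed.

Lemma is_diff_scale (R : realType) (V W : normedModType R) (k dk : V -> R)
    (w : W) (x : V) :
  is_diff x k dk -> is_diff x (fun y => k y *: w) (fun v => dk v *: w).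
Proof. by move=> dkx; exact: is_diff_comp dkx (is_diff_scalel _ _). Qed.

(** * Smoothness *)

Lemma smooth_on_cst (R : realType) (V W : normedModType R) (U : set V) (a : W) :
  smooth_on U (cst a).
Proof.
move=> k; elim: k a => [|k IH] a /=; first by move=> x _; exact: cst_continuous.
split=> [x _|v]; first exact: differentiable_cst.
by rewrite (_ : (fun x => _) = cst 0)//; apply/funext => x; exact: derive_cst.
Qed.

(** Reduces smoothness to that of the directional derivatives, which for
    polynomial maps have smaller degree. *)
Lemma smooth_on_diff (R : realType) (V W : normedModType R) (U : set V)
    (f : V -> W) (df : V -> V -> W) :
  (forall u, is_diff u f (df u)) -> (forall v, smooth_on U (df^~ v)) ->
  smooth_on U f.
Proof.
move=> fdf sdf [|k] /=.
  by move=> x _; apply: differentiable_continuous; have [] := fdf x.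
split=> [x _|v]; first by have [] := fdf x.
rewrite (_ : (fun x => _) = df^~ v); first exact: sdf.
by apply/funext => x; have [df1 <-] := fdf x; rewrite deriveE.
Qed.

Lemma smooth_on_line (R : realType) (W : normedModType R) (U : set R) (w : W) :
  smooth_on U ( *:%R^~ w : R -> W).
Proof.
pose f : R -> W := *:%R^~ w.
have df u : is_diff u f f by exact: is_diff_scalel.
exact: (@smooth_on_diff R R W U f (fun=> f) df (fun v => smooth_on_cst U (f v))).
Qed.

(** * The saddle and its chart *)

(** The third coordinate of such vectors is a linear function of the first two,
    so their independence is already visible in the horizontal projection. *)
Lemma minor_free (R : realType) (a b : R) (v w : 'rV[R]_3) :
  v 0 2 = a * v 0 1 + b * v 0 0 -> w 0 2 = a * w 0 1 + b * w 0 0 ->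
  free [:: v; w] -> v 0 0 * w 0 1 - v 0 1 * w 0 0 != 0.
Proof.
move=> v2 w2; rewrite free_cons seq1_free => /andP[vw w0].
apply/eqP => /subr0_eq m0.
(* If the minor vanishes, then w_x v = v_x w and w_y v = v_y w; as v is not on
   the line of w, this forces w_x = w_y = 0, hence w = 0. *)
have vw0 k l : k *: v = l *: w -> k = 0.
  move=> kv; apply/eqP/negPn/negP => k0; move/negP: vw; apply.
  rewrite span_seq1; apply/vlineP; exists (k^-1 * l).
  by rewrite -scalerA -kv scalerA mulVf// scale1r.
have w00 : w 0 0 = 0.
  by apply: (vw0 _ (v 0 0)); apply: row3P; rewrite !mxE ?v2 ?w2; ring: m0.
have w01 : w 0 1 = 0.
  by apply: (vw0 _ (v 0 1)); apply: row3P; rewrite !mxE ?v2 ?w2; ring: m0.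
move/eqP: w0; apply; apply: row3P; rewrite !mxE//.
by rewrite w2 w00 w01 !mulr0 addr0.
Qed.

Section saddle.
Variable R : realType.
Implicit Types p q w : 'rV[R]_3.

Definition saddle : set 'rV[R]_3 := [set p | p 0 2 = p 0 0 * p 0 1].

Definition saddle_chart (u : 'rV[R]_2) : 'rV[R]_3 :=
  \row_(i < 3) [:: u 0 0; u 0 1; u 0 0 * u 0 1]`_i.

Definition saddle_chart_diff (u v : 'rV[R]_2) : 'rV[R]_3 :=
  \row_(i < 3) [:: v 0 0; v 0 1; u 0 0 * v 0 1 + u 0 1 * v 0 0]`_i.

(** The Gauss map of the saddle, as a map defined on the whole space. *)
Definition saddle_normal p : 'rV[R]_3 :=
  \row_(i < 3) [:: - p 0 1; p 0 0; 2^-1 * (1 - (p 0 1 ^+ 2 - p 0 0 ^+ 2))]`_i.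

(** Leibniz rule for the equation z = x y.  The domain V is arbitrary so that
    the lemma covers both curves and parameterizations. *)
Lemma saddle_tangent (V : normedModType R) (c : V -> 'rV[R]_3) (t v : V) w :
  (\near t, saddle (c t)) -> is_derive t v c w ->
  w 0 2 = c t 0 0 * w 0 1 + c t 0 1 * w 0 0.
Proof.
move=> Sc /is_derive_mxP cw.
have := is_deriveM (cw 0 0) (cw 0 1).
have : is_derive t v ((fun x => c x 0 0 : R) * (fun x => c x 0 1 : R)) (w 0 2).
  apply: near_eq_is_derive (cw 0 2).
  by apply: filterS Sc => x.
by move=> [_ <-] [_ ->].
Qed.

Lemma saddle_chartE (u : 'rV[R]_2) : saddle_chart u =
  u 0 0 *: delta_mx 0 0 + u 0 1 *: delta_mx 0 1 + (u 0 0 * u 0 1) *: delta_mx 0 2.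
Proof. by apply: row3P; rewrite !mxE /=; ring. Qed.

Lemma is_diff_saddle_chart (u : 'rV[R]_2) :
  is_diff u saddle_chart (saddle_chart_diff u).
Proof.
have d0 := is_diff_coord u 0 0; have d1 := is_diff_coord u 0 1.
have d01 : is_diff u (fun v => v 0 0 * v 0 1)
    (fun v => u 0 0 * v 0 1 + u 0 1 * v 0 0) := is_diffM d0 d1.
have s0 := is_diff_scale (delta_mx 0 0 : 'rV[R]_3) d0.
have s1 := is_diff_scale (delta_mx 0 1 : 'rV[R]_3) d1.
have s2 := is_diff_scale (delta_mx 0 2 : 'rV[R]_3) d01.
have := is_diffD (is_diffD s0 s1) s2.
rewrite (_ : _ + _ + _ = saddle_chart); last first.
  by apply/funext => z; rewrite saddle_chartE.
move=> /is_diff_eq; apply.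
by apply/funext => z; apply: row3P; rewrite !mxE /=; ring.
Qed.

Lemma smooth_saddle_chart (U : set 'rV[R]_2) : smooth_on U saddle_chart.
Proof.
apply: (smooth_on_diff is_diff_saddle_chart) => v.
(* The differential is affine in the base point. *)
apply: (@smooth_on_diff R 'rV[R]_2 'rV[R]_3 U (saddle_chart_diff^~ v)
  (fun _ h => (h 0 0 * v 0 1 + h 0 1 * v 0 0) *: (delta_mx 0 2 : 'rV[R]_3))).
  move=> u.
  have d0 := is_diff_scale (v 0 1 : R^o) (is_diff_coord u 0 0).
  have d1 := is_diff_scale (v 0 0 : R^o) (is_diff_coord u 0 1).
  have d01 : is_diff u (fun h => h 0 0 * v 0 1 + h 0 1 * v 0 0)
    (fun h => h 0 0 * v 0 1 + h 0 1 * v 0 0) := is_diffD d0 d1.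
  have d := is_diff_scale (delta_mx 0 2 : 'rV[R]_3) d01.
  have := is_diffD (is_diff_cst (v 0 0 *: delta_mx 0 0 + v 0 1 *: delta_mx 0 1) u) d.
  rewrite (_ : cst _ + _ = saddle_chart_diff^~ v); last first.
    by apply/funext => z; apply: row3P; rewrite !mxE /=; ring.
  by move=> /is_diff_eq; apply; rewrite add0r.
by move=> h; exact: smooth_on_cst.
Qed.

Lemma partial_saddle_chart i u :
  partial saddle_chart i u = saddle_chart_diff u (delta_mx 0 i).
Proof.
rewrite /partial; have [d <-] := is_diff_saddle_chart u.
by rewrite deriveE.
Qed.

Lemma saddle_chartP u : saddle (saddle_chart u).
Proof. by rewrite /saddle /= !mxE. Qed.

Definition top_view p : 'rV[R]_2 :=
  p 0 0 *: delta_mx 0 0 + p 0 1 *: delta_mx 0 1.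

Lemma continuous_top_view : continuous top_view.
Proof.
move=> p; apply: differentiable_continuous.
have d0 := is_diff_scale (delta_mx 0 0 : 'rV[R]_2) (is_diff_coord p 0 0).
have d1 := is_diff_scale (delta_mx 0 1 : 'rV[R]_2) (is_diff_coord p 0 1).
by have [] := is_diffD d0 d1.
Qed.

Lemma saddle_chartK : cancel saddle_chart top_view.
Proof.
move=> u; apply/rowP => -[[|[|//]] hi]; rewrite !mxE /= !(mulr0, mulr1, addr0, add0r);
  congr (u _ _); exact: val_inj.
Qed.

Lemma top_viewK p : saddle p -> saddle_chart (top_view p) = p.
Proof.
move=> Sp; apply: row3P; rewrite !mxE /= ?Sp; ring.
Qed.

Lemma local_parameterization_saddle :
  local_parameterization saddle setT saddle_chart.
Proof.
split.
- exact: openT.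
- exact: smooth_saddle_chart.
- move=> u _; rewrite !partial_saddle_chart.
  rewrite free_cons seq1_free span_seq1; apply/andP; split.
    apply/negP => /vlineP[k /rowP /(_ 0)].
    by rewrite !mxE /= mulr0 => /eqP; rewrite oner_eq0.
  by apply/eqP => /rowP /(_ 1); rewrite !mxE /= => /eqP; rewrite oner_eq0.
- by move=> u v _ _; exact: (can_inj saddle_chartK).
- move=> A oA _.
  exists (top_view @^-1` A).
    by apply: open_comp => // p _; exact: continuous_top_view.
  rewrite eqEsubset; split=> [_ [u Au <-]|p [Sp Ap]].
    by split; [exact: saddle_chartP|rewrite /= saddle_chartK].
  by exists (top_view p) => //; exact: top_viewK.
Qed.

(** * Gauss map and shape operator of the saddle *)

(** The relation z_i = x y_i + y x_i between the partial derivatives makes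
    X_23 = - y X_12 and X_13 = x X_12, whatever the parameterization. *)
Lemma param_gauss_map_saddle U x u : local_parameterization saddle U x -> U u ->
  param_gauss_map x u = saddle_normal (x u).
Proof.
move=> [oU sx fx _ imx] Uu.
have Sx v : U v -> saddle (x v).
  move=> Uv; have [W _ e] := imx U oU (@subset_refl _ _).
  have : (x @` U) (x v) by exists v.
  by rewrite e => -[].
have nSx : \near u, saddle (x u).
  by apply: filterS (open_nbhs_nbhs (conj oU Uu)).
have dx i : is_derive u (delta_mx 0 i) x (partial x i u).
  apply: DeriveDef => //; apply: diff_derivable.
  by have [+ _] := sx 1%N; exact.
have t0 := saddle_tangent nSx (dx 0).
have t1 := saddle_tangent nSx (dx 1).
move: (fx u Uu) t0 t1; rewrite /param_gauss_map /minorX.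
move: (partial x 0 u) (partial x 1 u) => v w fvw v2 w2.
have m0 := minor_free v2 w2 fvw.
set m := _ - _ in m0.
have -> : v 0 1 * w 0 2 - v 0 2 * w 0 1 = - x u 0 1 * m by rewrite v2 w2 /m; ring.
have -> : v 0 0 * w 0 2 - v 0 2 * w 0 0 = x u 0 0 * m by rewrite v2 w2 /m; ring.
by rewrite -/m !mulfK// sqrrN.
Qed.

Lemma gauss_map_saddle q : saddle q -> gauss_map saddle q = saddle_normal q.
Proof.
move=> Sq; apply: xget_unique; last first.
  by move=> _ [U [x [u [Sx Uu <- ->]]]]; exact: param_gauss_map_saddle Sx Uu.
exists setT, saddle_chart, (top_view q); split => //.
- exact: local_parameterization_saddle.
- exact: top_viewK.
- by rewrite (param_gauss_map_saddle local_parameterization_saddle)// top_viewK.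
Qed.

Lemma curve_saddleP {q w c} : curve_through saddle q w c ->
  [/\ \forall t \near (0 : R), saddle (c t), c 0 = q & is_derive (0 : R) 1 c w].
Proof.
move=> [e e0 [sc Sc c0 cw]].
have ne : \forall t \near (0 : R), - e < t < e.
  by apply: near_in_itvoo; rewrite in_itv /= oppr_lt0 e0.
split => //; first by apply: filterS ne => t /Sc.
apply: DeriveDef => //; apply: diff_derivable.
by have [+ _] := sc 1%N; apply; rewrite /= in_itv /= oppr_lt0 e0.
Qed.

(** Any curve on the saddle with velocity w at q gives this derivative, and
    one exists since w is a tangent vector; hence the picked value. *)
Lemma shape_operator_saddle q w : tangent_space saddle q w ->
  shape_operator saddle q w =
    \row_(i < 3) [:: w 0 1; - w 0 0; q 0 1 * w 0 1 - q 0 0 * w 0 0]`_i.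
Proof.
set L := (X in _ = X).
have N c : curve_through saddle q w c ->
    is_derive (0 : R) (1 : R) (gauss_map saddle \o c) (- L).
  move=> /curve_saddleP[nS c0 /is_derive_mxP cw].
  have : is_derive (0 : R) 1 (saddle_normal \o c) (- L).
    apply/is_derive_mxP => i j; rewrite (ord1 i).
    pose f k t : R := c t 0 k.
    have fE k : f k 0 = q 0 k by rewrite /f c0.
    have df k : is_derive (0 : R) 1 (f k) (w 0 k) := cw 0 k.
    case: j => -[|[|[|//]]] hj.
    - rewrite (_ : (fun=> _) = - f 1); last by apply/funext => t; rewrite mxE.
      by apply: is_derive_eq; rewrite !mxE.
    - rewrite (_ : (fun=> _) = f 0); last by apply/funext => t; rewrite mxE.
      by apply: is_derive_eq; rewrite !mxE opprK.
    - rewrite (_ : (fun=> _) = 2^-1 \*: (cst 1 - (f 1 ^+ 2 - f 0 ^+ 2))).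
        by apply: is_derive_eq; rewrite !mxE /= !fE /GRing.scale /=; field.
      by apply/funext => t; rewrite mxE.
  apply: near_eq_is_derive; apply: filterS nS => t St.
  by rewrite /= gauss_map_saddle.
move=> [c cqw]; rewrite /shape_operator /surface_derive.
rewrite (@xget_unique _ _ _ (- L)) ?opprK//; first by exists c => //; exact: N.
by move=> d [c' /N[_ <-] [_ <-]].
Qed.

Lemma tangent_space_saddle q w : tangent_space saddle q w ->
  w 0 2 = q 0 0 * w 0 1 + q 0 1 * w 0 0.
Proof.
by move=> [c /curve_saddleP[nS <- cw]]; exact: saddle_tangent nS cw.
Qed.

(** Two points of a vertical line in a tangent plane differ by a vertical
    vector, while tangent vectors are determined by their horizontal part. *)
Lemma admissible_saddle : admissible saddle.
Proof.
split=> [q Sq|q Sq [p pT]].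
  exists setT, saddle_chart; split; first exact: local_parameterization_saddle.
  by exists (top_view q) => //; exact: top_viewK.
have [w0 /tangent_space_saddle T0 e0] := pT 0.
have [w1 /tangent_space_saddle T1 e1] := pT 1.
have : w1 = w0 + delta_mx 0 2.
  apply: (addrI q); rewrite e1 addrA e0 scale0r addr0 scale1r//.
move=> w1E; move: T1; rewrite w1E !mxE /= T0 !addr0 => /eqP.
by rewrite -subr_eq0 addrAC subrr add0r oner_eq0.
Qed.

(** The line x |-> (x, 0, 0) lies on the saddle.  One nonzero tangent vector is
    enough to exclude the empty basis of eigenvectors. *)
Lemma tangent_space_saddle0 : tangent_space saddle 0 (delta_mx 0 0).
Proof.
exists ( *:%R^~ (delta_mx 0 0)); exists 1 => //; split.
- exact: smooth_on_line.
- by move=> t _; rewrite /saddle /= !mxE /= !mulr0.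
- by rewrite scale0r.
- have d := is_diff_scalel (0 : R) (delta_mx 0 0 : 'rV[R]_3).
  by rewrite deriveE// diff_val scale1r.
Qed.

End saddle.

(** * A shape operator without real eigenvectors *)

Theorem mainTheorem13 (R : realType) :
  exists (S : set 'rV[R]_3) (q : 'rV[R]_3),
    [/\ admissible S, S q &
        ~ diagonalizable_on (tangent_space S q) (shape_operator S q)].
Proof.
exists (@saddle R), 0; split; first exact: admissible_saddle.
  by rewrite /saddle /= !mxE mulr0.
move=> [X [fX TX LX]].
have [v vX] : exists v, v \in X.
  case: X fX TX LX => [|v X] _ TX _; last by exists v; exact: mem_head.
  have := tangent_space_saddle0 R; rewrite TX /= span_nil memv0.
  by move=> /eqP /rowP /(_ 0); rewrite !mxE /= => /eqP; rewrite oner_eq0.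
have Tv : tangent_space (@saddle R) 0 v by rewrite TX /=; exact: memv_span.
have [a] := LX v vX; rewrite shape_operator_saddle// => /rowP e.
have e0 : v 0 1 = a * v 0 0 by have := e 0; rewrite !mxE.
have e1 : - v 0 0 = a * v 0 1 by have := e 1; rewrite !mxE.
(* An eigenvalue a of the rotation would satisfy a ^+ 2 = -1. *)
have v00 : v 0 0 = 0.
  have : (1 + a ^+ 2) * v 0 0 = 0.
    by rewrite mulrDl mul1r expr2 -mulrA -e0 -e1 subrr.
  by move/eqP; rewrite mulf_eq0 gt_eqF ?ltr_pwDl ?sqr_ge0//= => /eqP.
have /eqP := free_not0 fX vX; apply; apply: row3P; rewrite !mxE//.
  by rewrite e0 v00 mulr0.
by rewrite (tangent_space_saddle Tv) !mxE !mul0r addr0.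
Qed.
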